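(* Let $G=(V,E,\sigma,o)$ be a radially symmetric tree with radially symmetric weight $\sigma$. Suppose $p_0\in(1,\infty)$ and $\mathrm{Mod}_{p,\sigma}(\Gamma_\infty)>0$ for all $p$ in a neighborhood of $p_0$, and let $e\in E$. Then the function $p\mapsto\rho^*_p(e)$ is continuous at $p_0$, where $\rho^*_p$ is the unique optimal density for $\mathrm{Mod}_{p,\sigma}(\Gamma_\infty)$.
   Context: A weighted rooted tree $G=(V,E,\sigma,o)$ has root $o$ and weights $\sigma:E\to\mathbb{R}_{>0}$. The generation of an edge is the number of edges on the unique path from $o$ ending with it; $e$ is the parent of $e'$ if they are adjacent and $e'$ has generation one more. A proper infinite tree is infinite, locally finite, and every edge has at least one child; it is radially symmetric if the number of children of an edge depends only on its generation; $\sigma$ is radially symmetric if $\sigma(e)$ depends only on the generation of $e$. A descending path is a path $e_1e_2\cdots$ from $o$ with $e_i$ the parent of $e_{i+1}$; $\Gamma_\infty$ is the set of infinite descending paths. For $\rho:E\to[0,\infty)$, $\ell_\rho(\gamma)=\sum_{e\in\gamma}\rho(e)$; $\mathrm{Adm}(\Gamma_\infty)$ consists of $\rho\ge0$ with $\ell_\rho(\gamma)\ge1$ for all $\gamma\in\Gamma_\infty$; $\mathcal{E}_{p,\sigma}(\rho)=\sum_e\sigma(e)\rho(e)^p$; $\mathrm{Mod}_{p,\sigma}(\Gamma_\infty)=\inf_{\rho\in\mathrm{Adm}(\Gamma_\infty)}\mathcal{E}_{p,\sigma}(\rho)$. An optimal density is $\rho^*\in\mathrm{Adm}(\Gamma_\infty)$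 attaining this infimum. *)

(* Defs.v *)
From HB Require Import structures.
From mathcomp Require Import all_boot all_order all_algebra.
From mathcomp Require Import all_classical all_reals all_analysis.
Import Order.TTheory GRing.Theory Num.Theory.
Import numFieldNormedType.Exports.

Set Implicit Arguments.
Unset Strict Implicit.
Unset Printing Implicit Defensive.

Local Open Scope classical_set_scope.
Local Open Scope ring_scope.

(* A rooted tree is a connected acyclic simple graph with a chosen vertex; it
   may be infinite.  [cycle] counts the empty sequence and, adjacency being
   symmetric, [:: x; y] for adjacent x and y, so the cycles of graph theory are
   the duplicate-free ones with at least three vertices. *)
Record rooted_tree := RootedTree {
  vertex :> choiceType;
  adj : rel vertex;
  root : vertex;
  adj_sym : symmetric adj;
  adj_irr : irreflexive adj;
  adj_connected : forall x y, exists2 p, path adj x p & last x p = y;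
  adj_acyclic : forall c, ucycle adj c -> (size c <= 2)%N }.

Section Trees.
Variable G : rooted_tree.

Definition edge_set : set (set G) :=
  [set e | exists x y : G, adj x y /\ e = [set x; y]].

Definition edge : choiceType := edge_set.

Definition ends (e : edge) : set G := val e.

(* [root G :: rcons p y] is a path (without repeated vertices), and its last
   edge is e. *)
Definition path_ending_with (e : edge) (p : seq G) (y : G) :=
  [/\ path (@adj G) (root G) (rcons p y), uniq (root G :: rcons p y)
    & ends e = [set last (root G) p; y]].

(* The path [root G :: rcons p y] has [size p + 1] edges.  In a tree there is
   exactly one such path for each e, so the default value 0 is never taken. *)
Definition generation (e : edge) : nat :=
  xget 0%N [set n | exists p y, path_ending_with e p y /\ n = (size p).+1].

Definition adjacent_edges (e e' : edge) :=
  e <> e' /\ ends e `&` ends e' !=set0.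

Definition is_parent (e e' : edge) :=
  adjacent_edges e e' /\ generation e' = (generation e).+1.

Definition children (e : edge) : set edge := [set e' | is_parent e e'].

Definition locally_finite := forall x : G, finite_set [set y | adj x y].

Definition proper_infinite :=
  [/\ infinite_set [set: G], locally_finite & forall e, children e !=set0].

Definition radially_symmetric_tree :=
  proper_infinite /\
  exists c : nat -> nat, forall e, (children e #= `I_(c (generation e)))%card.

Definition infinite_path_from (x : G) (g : nat -> edge) :=
  exists v : nat -> G, [/\ v 0%N = x, injective v
    & forall i, ends (g i) = [set v i; v i.+1]].

Definition Gamma_infty : set (nat -> edge) :=
  [set g | infinite_path_from (root G) g /\
           forall i, is_parent (g i) (g i.+1)].

Section Modulus.
Variable R : realType.
Implicit Types (sigma rho : edge -> R) (p : R).

Definition radially_symmetric_weight sigma :=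
  exists s : nat -> R, forall e, sigma e = s (generation e).

Definition path_length rho (g : nat -> edge) : \bar R :=
  (\sum_(0 <= i <oo) (rho (g i))%:E)%E.

Definition Adm : set (edge -> R) :=
  [set rho | (forall e, 0 <= rho e) /\
             forall g, Gamma_infty g -> (1 <= path_length rho g)%E].

Definition energy p sigma rho : \bar R :=
  (\esum_(e in [set: edge]) (sigma e * rho e `^ p)%:E)%E.

Definition Mod p sigma : \bar R := ereal_inf [set energy p sigma rho | rho in Adm].

Definition optimal_density p sigma rho :=
  Adm rho /\ energy p sigma rho = Mod p sigma.

End Modulus.
End Trees.

(* Main.v *)
Require Import Defs.
From HB Require Import structures.
From mathcomp Require Import all_boot all_order all_algebra.
From mathcomp Require Import all_classical all_reals all_analysis.
From mathcomp Require Import finmap zify lra ring.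
Import Order.TTheory GRing.Theory Num.Theory.
Import numFieldNormedType.Exports.

Set Implicit Arguments.
Unset Strict Implicit.
Unset Printing Implicit Defensive.

Local Open Scope classical_set_scope.
Local Open Scope ring_scope.

(** Let [N n] be the number of edges of generation [n], [w n = sigma * N n] the
    total weight of that generation, and [u p n = w n `^ (-1 / (p - 1))].  The
    optimal density is radial, with value [u p n / S p] on generation [n], where
    [S p = \sum_n u p n].

    - [S p] is finite when the modulus is positive: the radial densities
      proportional to [u p] on the first [k] generations are admissible, of
      energy [(\sum_(n <= k) u p n) `^ (1 - p)].
    - Every admissible [rho] satisfies [\sum_e rho e / N (generation e) >= 1]:
      this is the mean length of a random descending path, and descending
      greedily, always into a subtree of at most average mean length, produces
      a path which is not longer than the mean.  The tangent-line inequality of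
      [x `^ p] at [u p n / S p], summed over the edges, then turns this bound
      into optimality; strict convexity gives uniqueness.
    - [u p n] is monotone in [p], so it is dominated near [p0] by the sum of its
      values at two points around [p0]; hence [S] is continuous at [p0]. *)

(** If the paths diverge after [a], going along one and back along the other is a walk from [b] to
    [b'] that avoids [a]. Shortened and closed up through [a], it is a simple cycle with at least
    three vertices. *)
Lemma acyclic_path_inj (T : eqType) (e : rel T) (a : T) (p q : seq T) :
  symmetric e -> (forall c, ucycle e c -> (size c <= 2)%N) ->
  path e a p -> path e a q -> uniq (a :: p) -> uniq (a :: q) ->
  last a p = last a q -> p = q.
Proof.
move=> esym eacyc.
elim: p a q => [|b p IH] a [|b' q] //=.
- by move=> _ _ _ /andP[+ _] aq; rewrite aq mem_last.
- by move=> _ _ /andP[+ _] _ aq; rewrite -aq mem_last.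
move=> /andP[ab bp] /andP[ab' b'q] /andP[abp ubp] /andP[ab'q ub'q] lastE.
have [bb'|bb'] := eqVneq b b'.
  by subst b'; congr cons; exact: (IH b q).
exfalso.
have revq : path e (last b' q) (rev (belast b' q)).
  by rewrite rev_path (eq_path (e' := e)) // => x y; rewrite esym.
have walk : path e b (p ++ rev (belast b' q)) by rewrite cat_path bp lastE.
have walk_end : last b (p ++ rev (belast b' q)) = b'.
  by rewrite last_cat lastE; case: (q) => //= c s; rewrite rev_cons last_rcons.
have a_walk : a \notin b :: (p ++ rev (belast b' q)).
  rewrite -cat_cons mem_cat negb_or abp mem_rev /=.
  by apply: contra ab'q; exact: mem_belast.
case/shortenP: walk walk_end => r br ubr subr rlast.
have r_neq0 : r != [::] by apply: contra_neq bb' => r0; rewrite -rlast r0.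
have /eacyc : ucycle e (a :: b :: r).
  rewrite /ucycle /cycle rcons_path /= ab br rlast esym ab' /=.
  rewrite -/(uniq (b :: r)) ubr andbT.
  apply: contra a_walk; rewrite !inE => /orP[->//|ar]; apply/orP; right.
  exact: (subr _ ar).
by case: (r) r_neq0.
Qed.

(** * Paths from the root and generations *)

Section Tree.
Variable G : rooted_tree.
Implicit Types (x y : G) (e f : edge G) (p : seq G).

Definition root_path x p :=
  [/\ path (@adj G) (Defs.root G) p, last (Defs.root G) p = x & uniq (Defs.root G :: p)].

Lemma root_path_exists x : exists p, root_path x p.
Proof.
have [p pp <-] := adj_connected (Defs.root G) x.
by case/shortenP: pp => q qp uq _; exists q.
Qed.

(** The root itself is left out, so the size of [trail x] is the depth of [x]. *)
Definition trail x : seq G := projT1 (cid (root_path_exists x)).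

Lemma trailP x : root_path x (trail x).
Proof. by rewrite /trail; case: cid. Qed.

Lemma root_path_trail x p : root_path x p -> p = trail x.
Proof.
move=> [pp lp up]; have [pt lt ut] := trailP x.
apply: (acyclic_path_inj (@adj_sym G) (@adj_acyclic G) pp pt up ut).
by rewrite lp lt.
Qed.

Lemma trail_inj : injective trail.
Proof.
by move=> x y xy; have [_ <- _] := trailP x; have [_ <- _] := trailP y; rewrite xy.
Qed.

Lemma trail_root : trail (Defs.root G) = [::].
Proof. by apply/esym/root_path_trail. Qed.

(** If [y] is off the trail of [x], appending it gives a simple path. Otherwise the part of the
    trail from [y] to [x] closes up to a cycle, so it consists of [y] and [x] only. *)
Lemma trail_adj x y : adj x y ->
  trail y = rcons (trail x) y \/ trail x = rcons (trail y) x.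
Proof.
move=> xy; have [px lx ux] := trailP x.
have [yx|yx] := boolP (y \in Defs.root G :: trail x); last first.
  left; apply/esym/root_path_trail; split; last 1 first.
  - by rewrite -rcons_cons rcons_uniq yx.
  - by rewrite rcons_path px lx.
  - by rewrite last_rcons.
right; case/splitPl: yx (root_path_trail) px lx ux => p1 p2 ly rpt.
rewrite cat_path last_cat ly -cat_cons cat_uniq => /andP[pp1 pp2] lx.
move=> /and3P[up1 disj up2].
have -> : trail y = p1 by apply/esym/rpt.
have uyp2 : uniq (y :: p2).
  rewrite /= up2 andbT; apply: contra disj => yp2; apply/hasP; exists y => //.
  by rewrite -ly mem_last.
have /adj_acyclic : ucycle (@adj G) (y :: p2).
  by rewrite /ucycle uyp2 andbT /cycle rcons_path pp2 lx.
case: p2 pp2 lx {disj up2 uyp2} => [|z [|//]] /=.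
  by move=> _ yx; rewrite yx adj_irr in xy.
by move=> _ -> _; rewrite cats1.
Qed.

Lemma edge_trail e : exists xy : G * G,
  ends e = [set xy.1; xy.2] /\ trail xy.2 = rcons (trail xy.1) xy.2.
Proof.
have /set_mem[x [y [xy exy]]] := valP e.
have [txy|tyx] := trail_adj xy; first by exists (x, y).
by exists (y, x); split => //=; rewrite setUC.
Qed.

Definition top e : G := (projT1 (cid (edge_trail e))).1.
Definition bot e : G := (projT1 (cid (edge_trail e))).2.

Lemma ends_top_bot e : ends e = [set top e; bot e].
Proof. by rewrite /top /bot; case: cid => ? []. Qed.

Lemma trail_bot e : trail (bot e) = rcons (trail (top e)) (bot e).
Proof. by rewrite /top /bot; case: cid => ? []. Qed.

Lemma size_trail_bot e : size (trail (bot e)) = (size (trail (top e))).+1.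
Proof. by rewrite trail_bot size_rcons. Qed.

Lemma bot_inj : injective bot.
Proof.
move=> e f ef; apply/val_inj; rewrite -!/(ends _) !ends_top_bot ef.
by have := trail_bot e; rewrite ef trail_bot => /rcons_inj[/trail_inj ->].
Qed.

Lemma ends_bot e x y : ends e = [set x; y] -> trail y = rcons (trail x) y ->
  x = top e /\ y = bot e.
Proof.
move=> exy txy; have ste := size_trail_bot e.
have sxy : size (trail y) = (size (trail x)).+1 by rewrite txy size_rcons.
have xe : ends e x by rewrite exy; left.
have ye : ends e y by rewrite exy; right.
move: xe ye; rewrite ends_top_bot => -[] /= xE [] /= yE //;
  move: sxy ste; rewrite xE yE; lia.
Qed.

Lemma edge_of_trail x y : trail y = rcons (trail x) y ->
  exists e, top e = x /\ bot e = y.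
Proof.
move=> txy; have [py ly uy] := trailP y; have [px lx ux] := trailP x.
have xy : adj x y by move: py; rewrite txy rcons_path lx => /andP[].
have exy : [set x; y] \in @edge_set G by apply/mem_set; exists x, y.
exists (exist (fun z => z \in @edge_set G) _ exy : edge G).
have [] // := @ends_bot (exist (fun z => z \in @edge_set G) _ exy : edge G) x y.
Qed.

Lemma generation_bot e : generation e = size (trail (bot e)).
Proof.
rewrite /generation.
case: xgetP => [n _ [p [y [[py uy ey] ->]]]|/(_ (size (trail (bot e))))].
  have ry : rcons p y = trail y by apply: root_path_trail; rewrite /root_path last_rcons.
  move: py uy; rewrite -rcons_cons rcons_path rcons_uniq => /andP[pp _] /andP[_ up].
  have rp : p = trail (last (Defs.root G) p) by exact: root_path_trail.
  have [|_ <-] := @ends_bot e _ _ ey; first by rewrite -rp.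
  by rewrite -ry size_rcons.
(* The default of [xget] is excluded: the trail of [bot e] is a path ending with [e]. *)
move=> []; exists (trail (top e)), (bot e); split; last by rewrite size_trail_bot.
rewrite /path_ending_with -rcons_cons -trail_bot.
have [pe le ue] := trailP (bot e); have [_ lt _] := trailP (top e).
by split; rewrite ?lt ?ends_top_bot // rcons_cons -trail_bot.
Qed.

Lemma generation_gt0 e : (0 < generation e)%N.
Proof. by rewrite generation_bot size_trail_bot. Qed.

Lemma is_parentE e f : is_parent e f <-> bot e = top f.
Proof.
rewrite /is_parent /adjacent_edges !generation_bot !ends_top_bot.
have se := size_trail_bot e; have sf := size_trail_bot f; split.
  by move=> [[_ [z []]]] /= [->|->] [] zE // sef; move: se sf; rewrite ?zE in sef *; lia.
move=> ef; split; last by rewrite ef.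
split; first by move=> eqef; move: ef; rewrite eqef => ef; move: sf; rewrite ef; lia.
by exists (bot e); split; [right|left].
Qed.

Lemma generation1 e : generation e = 1%N <-> top e = Defs.root G.
Proof.
rewrite generation_bot size_trail_bot; split=> [[] /size0nil t0|->];
  last by rewrite trail_root.
by apply: trail_inj; rewrite trail_root.
Qed.

Lemma Gamma_infty_generation (g : nat -> edge G) i :
  Gamma_infty g -> generation (g i) = i.+1.
Proof.
move=> [[v [v0 _ vE]] gpar]; elim: i => [|i IH];
  last by have [_ ->] := gpar i; rewrite IH.
apply/generation1; have := ends_top_bot (g 0%N); rewrite vE v0 => tb.
have : [set top (g 0%N); bot (g 0%N)] (Defs.root G) by rewrite -tb; left.
case=> [->//|/= rb]; have := size_trail_bot (g 0%N).
by rewrite -rb trail_root.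
Qed.

Lemma generation_parent e f : is_parent e f -> generation f = (generation e).+1.
Proof. by case. Qed.

Lemma is_parent_exists f : generation f != 1%N -> exists e, is_parent e f.
Proof.
move=> f1; have [pt lt ut] := trailP (top f).
move tE : (trail (top f)) => t; case/lastP: t tE => [t0|q z tE].
  by case/eqP: f1; apply/generation1/trail_inj; rewrite t0 trail_root.
have zt : z = top f by rewrite -lt tE last_rcons.
have [x tx] : exists x, trail x = q.
  exists (last (Defs.root G) q); apply/esym/root_path_trail; move: pt ut.
  by rewrite tE -rcons_cons rcons_path rcons_uniq => /andP[pq _] /andP[_ uq].
have [e [_ be]] : exists e, top e = x /\ bot e = top f.
  by apply: edge_of_trail; rewrite tx tE zt.
by exists e; apply/is_parentE.
Qed.

Lemma is_parent_inj e e' f : is_parent e f -> is_parent e' f -> e = e'.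
Proof. by move=> /is_parentE ef /is_parentE e'f; apply: bot_inj; rewrite ef e'f. Qed.

Lemma Gamma_infty_intro (g : nat -> edge G) :
  generation (g 0%N) = 1%N -> (forall i, is_parent (g i) (g i.+1)) -> Gamma_infty g.
Proof.
move=> g0 gpar; split => //; exists (fun i => top (g i)); split.
- exact/generation1.
(* The vertex [top (g k)] has depth [k], so these vertices are distinct. *)
- move=> i j ij; have gen k : (size (trail (top (g k)))).+1 = k.+1.
    rewrite -size_trail_bot -generation_bot.
    by elim: k => [//|k IH]; rewrite (generation_parent (gpar k)) IH.
  by have := gen j; rewrite -ij gen => -[].
- by move=> i; rewrite ends_top_bot; congr [set _; _]; exact/is_parentE.
Qed.

(** * Descendants and ancestors of edges *)

Definition descendants e : set (edge G) :=
  [set f | prefix (trail (bot e)) (trail (bot f))].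

(** Two prefixes of the same sequence with equal length coincide. *)
Lemma descendants_disjoint e e' f : generation e = generation e' ->
  descendants e f -> descendants e' f -> e = e'.
Proof.
rewrite !generation_bot /descendants /= !prefixE => ee' /eqP ef /eqP e'f.
by apply/bot_inj/trail_inj; rewrite -ef -e'f ee'.
Qed.

Lemma ancestor_exists f n : (0 < n <= generation f)%N ->
  exists2 e, generation e = n & descendants e f.
Proof.
move=> /andP[n0]; move mE : (generation f) => m; elim: m f mE => [|m IH] f mf.
  by rewrite leqNgt n0.
rewrite leq_eqVlt => /orP[/eqP ->|nm].
  by exists f => //; rewrite /descendants /= prefix_refl.
have [e pe] : exists e, is_parent e f.
  by apply: is_parent_exists; rewrite mf; case: (m) nm; case: (n) n0.
have [||e' ge' de'] := IH e.
- by have := generation_parent pe; rewrite mf => -[].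
- by [].
exists e' => //; rewrite /descendants /= in de' *; apply: (prefix_trans de').
by move/is_parentE: pe => ->; rewrite (trail_bot f) -cats1 prefix_prefix.
Qed.

Lemma descendants_generation e f : descendants e f ->
  (generation e <= generation f)%N.
Proof. by rewrite !generation_bot; exact: size_prefix. Qed.

Lemma descendants_same_generation e f : descendants e f ->
  generation e = generation f -> e = f.
Proof.
move=> ef gef; apply: (descendants_disjoint gef ef).
by rewrite /descendants /= prefix_refl.
Qed.

Lemma child_descendants e e' f : is_parent e e' -> descendants e' f ->
  descendants e f.
Proof.
move=> pe; rewrite /descendants /=; apply: prefix_trans.
by move/is_parentE: pe => ->; rewrite (trail_bot e') -cats1 prefix_prefix.
Qed.

(** A proper descendant [f] of [e] has an ancestor one generation after [e]. The parent of that
    ancestor has the generation of [e] and also precedes [f], hence it is [e]. *)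
Lemma descendantsE e :
  descendants e = [set e] `|` \bigcup_(e' in children e) descendants e'.
Proof.
apply/seteqP; split => f; last first.
  by case=> [->|[e' pe' /(child_descendants pe')//]]; rewrite /descendants /= prefix_refl.
move=> ef; have := descendants_generation ef; rewrite leq_eqVlt => /orP[/eqP gef|gef].
  by left; rewrite /= (descendants_same_generation ef gef).
have [e' ge' e'f] : exists2 e', generation e' = (generation e).+1 & descendants e' f.
  exact: ancestor_exists.
right; exists e' => //.
have [|e'' pe''] := @is_parent_exists e'.
  by rewrite ge' eqSS -lt0n generation_gt0.
have [_ ge''] := pe''; rewrite ge' in ge''; case: ge'' => ge''.
by rewrite (descendants_disjoint ge'' ef (child_descendants pe'' e'f)).
Qed.

End Tree.

(** * The unit flow and mean path lengths *)

Lemma esum_cst (R : realType) (T : choiceType) (A : set T) (x : R) :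
  finite_set A -> 0 <= x ->
  (\esum_(i in A) x%:E = (#|` fset_set A|%:R * x)%:E)%E.
Proof.
move=> finA x0; rewrite esum_fset //.
by rewrite fsbig_finite //= sumEFin big_const_seq count_predT iter_addr_0 mulr_natl.
Qed.

Lemma esumZl (R : realType) (T : choiceType) (A : set T) (a : T -> \bar R) (r : R) :
  0 <= r -> (forall i, 0 <= a i)%E ->
  (\esum_(i in A) (r%:E * a i) = r%:E * \esum_(i in A) a i)%E.
Proof.
move=> r0 a0; rewrite /esum -ereal_supZl //; last first.
  by apply/set0P; exists (\sum_(i \in set0) a i)%E, set0 => //; exact: fsets_set0.
congr ereal_sup; rewrite image_comp; apply: eq_imagel => X _ /=.
by rewrite ge0_mule_fsumr.
Qed.

Lemma esum_bigcup_trivIset (R : realType) (T I : choiceType) (K : set I)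
    (J : I -> set T) (a : T -> \bar R) :
  trivIset K J -> (forall x, 0 <= a x)%E ->
  (\esum_(i in \bigcup_(k in K) J k) a i = \esum_(k in K) \esum_(i in J k) a i)%E.
Proof.
move=> tJ a0; rewrite esum_esum //; apply: (reindex_esum _ _ snd); split.
- by move=> [k x] [Kk Jkx]; exists k.
- move=> [k x] [k' x'] /set_mem[/= Kk Jkx] /set_mem[/= Kk' Jk'x'] /= xx'; subst x'.
  by congr (_, _); apply: tJ => //; exists x.
- by move=> x [k Kk Jkx]; exists (k, x).
Qed.

(** * Levels of a radially symmetric tree and their sizes *)

Section RadialTree.
Variables (R : realType) (G : rooted_tree) (c : nat -> nat).
Hypothesis G_locally_finite : locally_finite G.
Hypothesis G_children : forall e : edge G, children e !=set0.
Hypothesis G_card_children :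
  forall e : edge G, (children e #= `I_(c (generation e)))%card.
Implicit Types (e f : edge G) (n : nat).

(** Generations start at one; the shift lets series over levels start at zero. *)
Definition level n : set (edge G) := [set e | generation e = n.+1].

Lemma level_trivIset (D : set nat) : trivIset D level.
Proof. by move=> i j _ _ [e []]; rewrite /level /= => -> []. Qed.

Lemma bigcup_level : \bigcup_n level n = [set: edge G].
Proof.
apply/seteqP; split => // e _; exists (generation e).-1 => //=.
by rewrite /level /= prednK // generation_gt0.
Qed.

Lemma levelS n : level n.+1 = \bigcup_(e in level n) children e.
Proof.
apply/seteqP; split => f; rewrite /level /=.
  move=> fn; have [|e pe] := @is_parent_exists _ f; first by rewrite fn.
  exists e => //; have := generation_parent pe.
  by rewrite fn => -[].
by case=> e /= en pe; rewrite (generation_parent pe) en.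
Qed.

Lemma children_trivIset (D : set (edge G)) : trivIset D (@children G).
Proof. by move=> e e' _ _ [f [/= ef e'f]]; exact: is_parent_inj ef e'f. Qed.

Lemma finite_children e : finite_set (children e).
Proof. by apply/finite_setP; exists (c (generation e)). Qed.

Lemma finite_level n : finite_set (level n).
Proof.
elim: n => [|n IH]; last first.
  by rewrite levelS; apply: bigcup_finite => // e _; exact: finite_children.
apply: (@sub_finite_set _ _ (@bot G @^-1` [set y | adj (Defs.root G) y])).
  move=> e /generation1 e0 /=; have [+ _ _] := trailP (bot e).
  have [_ lt _] := trailP (top e).
  by rewrite trail_bot rcons_path lt e0 => /andP[].
by apply: finite_preimage; [move=> ? ? _ _; exact: bot_inj|exact: G_locally_finite].
Qed.

Definition level_size n : nat := #|` fset_set (level n)|.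

Lemma level_sizeS n : level_size n.+1 = (level_size n * c n.+1)%N.
Proof.
(* Cardinalities are written as sums of ones, so that the disjoint union of the sets of children can
   be summed set by set. *)
have ES : (\esum_(e in level n.+1) 1%:E = (level_size n.+1)%:R%:E :> \bar R)%E.
  by rewrite esum_cst ?mulr1 //; exact: finite_level.
apply/eqP; rewrite -(eqr_nat R) natrM -eqe -ES levelS.
rewrite esum_bigcup_trivIset ?lee_fin //; last exact: children_trivIset.
apply/eqP.
rewrite (eq_esum (b := fun=> (c n.+1)%:R%:E)); last first.
  move=> e en; rewrite esum_cst //; last exact: finite_children.
  by rewrite (card_fset_set (G_card_children e)) en mulr1.
by rewrite esum_cst //; exact: finite_level.
Qed.

Lemma branching_gt0 e : (0 < c (generation e))%N.
Proof.
have := G_card_children e; case: (c _) => // /card_fset_set/cardfs0_eq c0.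
have [f ef] := G_children e.
have : f \in fset_set (children e).
  by rewrite in_fset_set; [exact: mem_set|exact: finite_children].
by rewrite c0 inE.
Qed.

Lemma level_size_gt0 n e : (0 < level_size n)%N.
Proof.
have [f ff] : level n !=set0.
  elim: n => [|n [f ff]].
    have [|f gf _] := @ancestor_exists _ e 1%N; first by rewrite generation_gt0.
    by exists f.
  have [f' pf] := G_children f; exists f'.
  by rewrite /level /= (generation_parent pf) ff.
rewrite cardfs_gt0; apply/fset0Pn; exists f.
by rewrite in_fset_set; [exact: mem_set|exact: finite_level].
Qed.

Local Open Scope ereal_scope.

Lemma esum_level (h : edge G -> \bar R) : (forall e, 0 <= h e) ->
  \esum_(e in [set: edge G]) h e = \sum_(0 <= n <oo) \esum_(e in level n) h e.
Proof.
move=> h0; rewrite -bigcup_level nneseries_sum_bigcup //.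
exact: level_trivIset.
Qed.

Lemma esum_radial (h : nat -> R) : (forall n, (0 <= h n)%R) ->
  \esum_(e in [set: edge G]) (h (generation e).-1)%:E =
  \sum_(0 <= n <oo) ((level_size n)%:R * h n)%:E.
Proof.
move=> h0; rewrite esum_level; last by move=> e; rewrite lee_fin.
apply: eq_eseriesr => n _.
rewrite (eq_esum (b := fun=> (h n)%:E)); last by move=> e ->.
by rewrite esum_cst //; exact: finite_level.
Qed.

(* The unit flow from the root that splits equally at every vertex. *)
Definition flow e : R := ((level_size (generation e).-1)%:R^-1)%R.

Lemma flow_gt0 e : (0 < flow e)%R.
Proof. by rewrite invr_gt0 ltr0n level_size_gt0. Qed.

Lemma flow_children e f : is_parent e f ->
  flow e = ((c (generation e))%:R * flow f)%R.
Proof.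
move=> pe; rewrite /flow (generation_parent pe) /=.
case: (generation e) (generation_gt0 e) (branching_gt0 e) => // n _ cn.
by rewrite level_sizeS /= natrM invfM mulrCA divff ?mulr1 // pnatr_eq0 -lt0n.
Qed.

(** * Greedy descent into subtrees of small mean length *)

Section Greedy.
Variable rho : edge G -> R.
Hypothesis rho_ge0 : forall e, (0 <= rho e)%R.

(** Divided by [flow e], this is the mean length, from [e] onwards, of a random descending path
    conditioned to pass through [e]. *)
Definition flow_length e : \bar R :=
  \esum_(f in descendants e) (rho f * flow f)%:E.

Let rho_flow_ge0 f : 0 <= (rho f * flow f)%:E.
Proof. by rewrite lee_fin mulr_ge0 // ltW // flow_gt0. Qed.

Lemma flow_length_ge0 e : 0 <= flow_length e.
Proof. exact: esum_ge0. Qed.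

Lemma descendants_trivIset n : trivIset (level n) (@descendants G).
Proof.
move=> e e' en e'n [f [ef e'f]]; apply: (descendants_disjoint _ ef e'f).
by rewrite en e'n.
Qed.

Lemma flow_lengthE e : flow_length e =
  (rho e * flow e)%:E + \esum_(f in children e) flow_length f.
Proof.
rewrite /flow_length (esumID [set e]) // setIC; congr (_ + _).
  rewrite (_ : _ `&` _ = [set e]) ?esum_set1 //.
  by apply/setIidl => f ->; rewrite descendantsE; left.
rewrite -esum_bigcup_trivIset //; last first.
  move=> f f' /generation_parent gf /generation_parent gf'.
  by apply: (descendants_trivIset (n := generation e)) => //=; rewrite /level /= ?gf ?gf'.
congr (esum _ _); rewrite descendantsE setIUl setICr set0U.
apply/setIidl => f [e' /generation_parent ge' /descendants_generation + fe].
by rewrite fe ge' ltnn.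
Qed.

(** If every child had mean length at least [a - rho e], conservation of the flow would give [e]
    mean length at least [a]. *)
Lemma flow_length_step e (a : R) : flow_length e < (a * flow e)%:E ->
  exists2 f, is_parent e f & flow_length f < ((a - rho e) * flow f)%:E.
Proof.
move=> ea; apply: contrapT => noc.
(* [esum_cst] needs a nonnegative constant; the term of [e] alone in [flow_length e] already forces
   [rho e < a]. *)
have a_rho : (0 <= a - rho e)%R.
  have : (rho e * flow e)%:E < (a * flow e)%:E.
    apply: le_lt_trans ea; rewrite flow_lengthE leeDl //.
    by apply: esum_ge0 => f _; exact: flow_length_ge0.
  by rewrite lte_fin ltr_pM2r ?flow_gt0 // subr_ge0 => /ltW.
move: ea; apply/negP; rewrite -leNgt flow_lengthE.
have [g pg] := G_children e.
have -> : (a * flow e)%:E =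
    (rho e * flow e)%:E + \esum_(f in children e) ((a - rho e) * flow g)%:E.
  rewrite esum_cst; last 2 first.
  - exact: finite_children.
  - by rewrite mulr_ge0 // ltW // flow_gt0.
  rewrite (card_fset_set (G_card_children e)) -EFinD (flow_children pg).
  by congr _%:E; ring.
apply: leeD => //; apply: le_esum => f pf; rewrite leNgt; apply/negP => fa.
apply: noc; exists f => //; rewrite (_ : flow f = flow g) //.
by rewrite /flow (generation_parent pf) (generation_parent pg).
Qed.

(** The same averaging at the root: the subtrees below the first generation partition the edges, and
    the flow through that generation is one. *)
Lemma flow_length_start (e0 : edge G) (a : R) :
  \esum_(e in [set: edge G]) (rho e * flow e)%:E < a%:E ->
  exists2 e, generation e = 1%N & flow_length e < (a * flow e)%:E.
Proof.
move=> ta; apply: contrapT => noe.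
have a0 : (0 <= a)%R.
  have : 0 < a%:E by apply: le_lt_trans ta; exact: esum_ge0.
  by rewrite lte_fin => /ltW.
move: ta; apply/negP; rewrite -leNgt.
have -> : [set: edge G] = \bigcup_(e in level 0) descendants e.
  apply/seteqP; split => // f _; have [|e ge ef] := @ancestor_exists _ f 1%N.
    by rewrite generation_gt0.
  by exists e.
rewrite esum_bigcup_trivIset //; last exact: descendants_trivIset.
have -> : a%:E = \esum_(e in level 0) (a * (level_size 0)%:R^-1)%:E.
  rewrite esum_cst; last 2 first.
  - exact: finite_level.
  - by rewrite mulr_ge0.
  by rewrite mulrCA divff ?mulr1 // pnatr_eq0 -lt0n (level_size_gt0 _ e0).
apply: le_esum => e e1; rewrite leNgt; apply/negP => ea.
by apply: noe; exists e => //; move: ea; rewrite /flow e1.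
Qed.

Lemma esum_flow_ge1 (e : edge G) : (forall g, Gamma_infty g -> 1 <= path_length rho g) ->
  1 <= \esum_(e in [set: edge G]) (rho e * flow e)%:E.
Proof.
move=> adm; rewrite leNgt; apply/negP => lt1.
have [a []] : exists a : R, (a < 1)%R /\
    \esum_(e in [set: edge G]) (rho e * flow e)%:E < a%:E.
  have : 0 <= \esum_(e in [set: edge G]) (rho e * flow e)%:E by exact: esum_ge0.
  case: (esum _ _) lt1 => [r||] //; rewrite !lte_fin => r1 _.
  by exists ((r + 1) / 2)%R; rewrite lte_fin; split; lra.
move=> a1 /(flow_length_start e)[e0 ge0 e0a].
(* A state is an edge with the length budget left for the path from it on. The implication makes the
   step total, as [dependent_choice] requires. *)
have step (s : edge G * R) : {t : edge G * R | flow_length s.1 < (s.2 * flow s.1)%:E ->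
    [/\ is_parent s.1 t.1, t.2 = (s.2 - rho s.1)%R
      & flow_length t.1 < (t.2 * flow t.1)%:E]}.
  apply: cid; case: s => f b /=.
  have [/flow_length_step[f' pf fb]|] := boolP (flow_length f < (b * flow f)%:E).
    by exists (f', (b - rho f)%R).
  by exists (f, b).
have [s [s0 sS]] := dependent_choice step (e0, a).
have inv n : flow_length (s n).1 < ((s n).2 * flow (s n).1)%:E.
  by elim: n => [|n /sS[]//]; rewrite s0.
pose g n := (s n).1.
have gG : Gamma_infty g.
  apply: Gamma_infty_intro; first by rewrite /g s0.
  by move=> i; have [] := sS i (inv i).
have budget n : (\sum_(0 <= i < n) rho (g i) + (s n).2 = a)%R.
  elim: n => [|n IH]; first by rewrite big_geq // add0r s0.
  have [_ -> _] := sS n (inv n).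
  by rewrite big_nat_recr //= -IH /g; ring.
have := adm g gG; apply/negP; rewrite -ltNge.
apply: (@le_lt_trans _ _ a%:E); last by rewrite lte_fin.
apply: lime_le; first by apply: is_cvg_nneseries => n _ _; rewrite lee_fin.
(* The budget left is never negative, so every partial length is at most [a < 1]. *)
near=> n; rewrite sumEFin lee_fin -(budget n) lerDl.
have := inv n => /(le_lt_trans (flow_length_ge0 _)).
by rewrite lte_fin pmulr_lgt0 ?flow_gt0 // => /ltW.
Unshelve. all: by end_near. Qed.

End Greedy.
End RadialTree.

(** * Series and the optimal profile *)

Section Series.
Variable R : realType.
Implicit Types (u M : nat -> R).

Lemma nneseries_EFinMr u (k : R) : cvgn (series u) ->
  (\sum_(0 <= n <oo) (u n * k)%:E = (limn (series u) * k)%:E)%E.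
Proof.
move=> cu; apply/cvg_lim => //.
rewrite (_ : (fun n => _) = EFin \o (fun n => series u n * k)); last first.
  by apply/funext => n /=; rewrite sumEFin mulr_suml.
apply: cvg_EFin; first by apply: nearW.
exact: (cvgM cu (cvg_cst _)).
Qed.

(** The upper bound holds because the partial sums of [M - u], whose terms are nonnegative, lie
    below their limit. *)
Lemma series_tail_le u M N : (forall n, 0 <= u n <= M n) -> cvgn (series M) ->
  0 <= limn (series u) - series u N <= limn (series M) - series M N.
Proof.
move=> uM cM; have u0 n : 0 <= u n by have /andP[] := uM n.
have uleM n : u n <= M n by have /andP[] := uM n.
have cu : cvgn (series u).
  by apply: (series_le_cvg u0 _ uleM cM) => n; exact: le_trans (uleM n).
rewrite subr_ge0 nondecreasing_cvgn_le //=; last exact: nondecreasing_series.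
have serB : series (M - u) = series M - series u.
  by apply/funext => n; rewrite /series /= fctE sumrB.
have : series (M - u) N <= limn (series (M - u)).
  apply: nondecreasing_cvgn_le; last by rewrite serB; exact: is_cvgB.
  by apply: nondecreasing_series => n _ _; rewrite subr_ge0.
rewrite serB limB // => h.
have : series M N - series u N <= limn (series M) - limn (series u) by exact: h.
lra.
Qed.

(** Weierstrass M-test: the tail of [M] bounds the tails of all [f x] with [x] near [x0], which
    leaves a finite sum of continuous functions. *)
Lemma continuous_series (f : R -> nat -> R) M (x0 : R) :
  (\forall x \near x0, forall n, 0 <= f x n <= M n) ->
  (forall n, {for x0, continuous (f ^~ n)}) -> cvgn (series M) ->
  {for x0, continuous (fun x => limn (series (f x)))}.
Proof.
move=> fM fcont cM; apply/cvgrPdist_lt => /= e e0.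
have e3 : 0 < e / 3 by lra.
have /cvgrPdist_lt/(_ _ e3)[N _ /(_ N (leqnn N)) /=] := cM.
move=> /ltr_normlP[_ tailN].
have fN : (fun x => series (f x) N) @ x0 --> series (f x0) N.
  by apply: cvg_big => [|n _]; [exact: add_continuous|exact: fcont].
have fM0 := nbhs_singleton fM.
have := series_tail_le N fM0 cM => /andP[t0 t0'].
near=> x.
have fMx : forall n, 0 <= f x n <= M n by near: x.
have /andP[tx tx'] := series_tail_le N fMx cM.
have /ltr_normlP[d1 d2] : `|series (f x0) N - series (f x) N| < e / 3.
  by near: x; move/cvgrPdist_lt: fN; exact.
apply/ltr_normlP; split; lra.
Unshelve. all: by end_near. Qed.

Lemma powR_subr1 (x p : R) : 0 < x -> x `^ p = x `^ (p - 1) * x.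
Proof.
move=> x0; have /powRD : (p - 1 + 1 == 0) ==> (x != 0) by rewrite (gt_eqF x0) implybT.
by rewrite subrK powRr1 ?(ltW x0).
Qed.

(** For [x = r * expR y], division by the [p]-th power of [r] leaves
    [p * expR y <= expR (p * y) + (p - 1)]. This combines [1 + t <= expR t] at [t = (p - 1) * y] and
    [t = - y], with factors [expR y] and [(p - 1) * expR y]; both are strict unless [y = 0]. *)
Lemma young_tangent (p x r : R) : 1 < p -> 0 <= x -> 0 < r ->
  p * r `^ (p - 1) * x <= x `^ p + (p - 1) * r `^ p ?= iff (x == r).
Proof.
move=> p1 x0 r0.
have rp := powR_subr1 p r0.
have rp1 : 0 < r `^ (p - 1) by exact: powR_gt0.
rewrite rp; have [->|xr] := eqVneq x r.
  apply/leifP; rewrite rp; apply/eqP; ring.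
apply/leifP => /=.
have [->|xn0] := eqVneq x 0.
  rewrite mulr0 powR0; last lra.
  by rewrite add0r !mulr_gt0 //; lra.
have {x0 xn0}x0 : 0 < x by rewrite lt_neqAle eq_sym xn0.
have [y xE] : exists y, x = r * expR y.
  by exists (ln (x / r)); rewrite lnK ?posrE ?divr_gt0 // mulrCA divff ?mulr1 ?gt_eqF.
have yn0 : y != 0.
  by apply/eqP => y0; rewrite xE y0 expR0 mulr1 eqxx in xr.
have -> : x `^ p = r `^ (p - 1) * r * expR (p * y).
  by rewrite xE powRM ?expR_ge0 ?(ltW r0) // rp (mulrC p) expRM.
have h1 : 1 + (p - 1) * y < expR ((p - 1) * y).
  by apply: expR_gt1Dx; rewrite mulf_neq0 //; lra.
have h2 : 1 + - y < expR (- y) by apply: expR_gt1Dx; rewrite oppr_eq0.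
have -> : p * y = y + (p - 1) * y by ring.
rewrite expRD {1}xE.
have -> : p * r `^ (p - 1) * (r * expR y) = (r `^ (p - 1) * r) * (p * expR y) by ring.
have -> : r `^ (p - 1) * r * (expR y * expR ((p - 1) * y)) + (p - 1) * (r `^ (p - 1) * r)
  = (r `^ (p - 1) * r) * (expR y * expR ((p - 1) * y) + (p - 1)) by ring.
rewrite ltr_pM2l ?mulr_gt0 //.
have ey := expR_gt0 y.
have eNy : expR y * expR (- y) = 1 by rewrite -expRD subrr expR0.
have k1 : expR y * (1 + (p - 1) * y) < expR y * expR ((p - 1) * y) by rewrite ltr_pM2l.
have k2 : expR y * (1 - y) < 1 by rewrite -[ltRHS]eNy ltr_pM2l.
have k3 : (p - 1) * (expR y * (1 - y)) < (p - 1) * 1 by rewrite ltr_pM2l //; lra.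
have -> : p * expR y = expR y * (1 + (p - 1) * y) + (p - 1) * (expR y * (1 - y)) by ring.
lra.
Qed.
End Series.

(** * The minimizing profile and its dependence on the exponent *)

Section Profile.
Variables (R : realType) (w : nat -> R).
Hypothesis w_gt0 : forall n, 0 < w n.
Implicit Types (p : R) (n : nat).

(* Up to normalization, the minimizer of [\sum_n w n * r n `^ p] subject to
   [\sum_n r n = 1]. *)
Definition profile p n : R := w n `^ (- (p - 1)^-1).

Lemma profile_gt0 p n : 0 < profile p n.
Proof. exact: powR_gt0. Qed.

(** The Euler-Lagrange condition: up to the factor [p], this is the derivative of the energy in the
    [n]-th coordinate, and it does not depend on [n]. *)
Lemma profile_powB1 p n : 1 < p -> w n * profile p n `^ (p - 1) = 1.
Proof.
move=> p1; rewrite /profile -powRrM mulNr mulVf ?powR_inv1 ?(ltW (w_gt0 n)) //.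
  by rewrite divff ?gt_eqF.
by rewrite gt_eqF //; lra.
Qed.

Lemma profile_pow p n (k : R) : 1 < p -> 0 < k ->
  w n * (profile p n * k) `^ p = profile p n * (k * k `^ (p - 1)).
Proof.
move=> p1 k0.
rewrite powRM ?(ltW (profile_gt0 _ _)) ?(ltW k0) // !(powR_subr1 p) ?profile_gt0 //.
transitivity (w n * profile p n `^ (p - 1) * (profile p n * (k * k `^ (p - 1)))).
  by ring.
by rewrite profile_powB1 // mul1r.
Qed.

Lemma profile_continuous p0 n : 1 < p0 -> {for p0, continuous (profile ^~ n)}.
Proof.
move=> p01; rewrite /profile /powR gt_eqF //.
apply: continuous_comp; last exact: continuous_expR.
apply: cvgM; last exact: cvg_cst.
apply: cvgN; apply: cvgV; first by rewrite gt_eqF //; lra.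
by apply: cvgB; [exact: cvg_id|exact: cvg_cst].
Qed.

(** The exponent [- (p - 1)^-1] increases with [p], so the profile increases if [w n >= 1] and
    decreases if [w n <= 1]. The case may vary with [n]; the sum of both end values covers
    either. *)
Lemma profile_le p1 p p2 n : 1 < p1 -> p1 <= p -> p <= p2 ->
  0 <= profile p n <= profile p1 n + profile p2 n.
Proof.
move=> p11 p1p pp2; rewrite ltW ?profile_gt0 //=.
have q1 : (p - 1)^-1 <= (p1 - 1)^-1 by rewrite lef_pV2 ?posrE; lra.
have q2 : (p2 - 1)^-1 <= (p - 1)^-1 by rewrite lef_pV2 ?posrE; lra.
have g1 := profile_gt0 p1 n; have g2 := profile_gt0 p2 n.
suff : profile p n <= profile p1 n \/ profile p n <= profile p2 n by case; lra.
rewrite /profile /powR gt_eqF // !ler_expR.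
have [l0|/ltW l0] := leP 0 (ln (w n)).
  by right; apply: ler_wpM2r => //; rewrite lerN2.
by left; apply: ler_wnM2r => //; rewrite lerN2.
Qed.

Lemma continuous_sum_profile p0 : 1 < p0 ->
  (\forall p \near p0, cvgn (series (profile p))) ->
  {for p0, continuous (fun p => limn (series (profile p)))}.
Proof.
move=> p01 /nbhs_ballP[d /= d0 cvgd].
(* Small enough that [p0 - h] and [p0 + h] stay in the ball of convergence and [p0 - h] stays above
   one. *)
pose h := Num.min (d / 2) ((p0 - 1) / 2).
have h0 : 0 < h by rewrite lt_min; apply/andP; split; lra.
have hd : h <= d / 2 by rewrite ge_min lexx.
have hp : h <= (p0 - 1) / 2 by rewrite ge_min lexx orbT.
have c1 : cvgn (series (profile (p0 - h))).
  by apply: cvgd; rewrite /ball /= ltr_norml; lra.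
have c2 : cvgn (series (profile (p0 + h))).
  by apply: cvgd; rewrite /ball /= ltr_norml; lra.
apply: (continuous_series (M := profile (p0 - h) + profile (p0 + h))).
- near=> p => n.
  have /ltr_normlP[ph1 ph2] : `|p0 - p| < h by near: p; exact: nbhsx_ballx.
  by apply: profile_le; lra.
- by move=> n; exact: profile_continuous.
- exact: is_cvg_seriesD.
Unshelve. all: by end_near. Qed.

Lemma sum_profile_gt0 p : cvgn (series (profile p)) -> 0 < limn (series (profile p)).
Proof.
move=> cu; apply: (@lt_le_trans _ _ (series (profile p) 1%N)).
  by rewrite /series /= big_nat1 profile_gt0.
apply: nondecreasing_cvgn_le => //.
by apply: nondecreasing_series => n _ _; exact/ltW/profile_gt0.
Qed.

End Profile.

(** * The modulus of a radially symmetric tree *)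

Section RadialModulus.
Variables (R : realType) (G : rooted_tree) (sigma : edge G -> R)
  (c : nat -> nat) (s : nat -> R) (e0 : edge G).
Hypothesis sigma_gt0 : forall e, 0 < sigma e.
Hypothesis sigmaE : forall e, sigma e = s (generation e).
Hypothesis G_locally_finite : locally_finite G.
Hypothesis G_children : forall e : edge G, children e !=set0.
Hypothesis G_card_children :
  forall e : edge G, (children e #= `I_(c (generation e)))%card.
Implicit Types (e : edge G) (n : nat) (p : R) (h : nat -> R).

Definition level_weight n : R := s n.+1 * (level_size G n)%:R.

Lemma level_weight_gt0 n : 0 < level_weight n.
Proof.
have N0 := level_size_gt0 G_locally_finite G_children G_card_children n e0.
rewrite mulr_gt0 ?ltr0n //; move: N0; rewrite cardfs_gt0 => /fset0Pn[f].
rewrite in_fset_set; last exact: (finite_level G_locally_finite G_card_children).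
by move=> /set_mem fn; rewrite -fn -sigmaE.
Qed.

Definition radial h e : R := h (generation e).-1.

Lemma path_length_radial h g : Gamma_infty g ->
  path_length (radial h) g = (\sum_(0 <= n <oo) (h n)%:E)%E.
Proof.
move=> gG; apply: eq_eseriesr => n _.
by rewrite /radial (Gamma_infty_generation n gG).
Qed.

Lemma energy_radial p h : (forall n, 0 <= h n) ->
  energy p sigma (radial h) = (\sum_(0 <= n <oo) (level_weight n * h n `^ p)%:E)%E.
Proof.
move=> h0; rewrite /energy.
rewrite (eq_esum (b := fun e =>
  (s (generation e).-1.+1 * h (generation e).-1 `^ p)%:E)); last first.
  by move=> e _; rewrite sigmaE prednK // generation_gt0.
have s0 n : 0 <= s n.+1.
  have := level_weight_gt0 n; rewrite pmulr_lgt0 ?ltr0n; first exact: ltW.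
  exact: level_size_gt0 G_locally_finite G_children G_card_children n e0.
rewrite (@esum_radial _ _ _ G_locally_finite G_card_children
  (fun n => s n.+1 * h n `^ p)).
  by apply: eq_eseriesr => n _; rewrite mulrA (mulrC _ (s _)).
by move=> n; rewrite mulr_ge0 ?powR_ge0.
Qed.

Local Notation u := (profile level_weight).

Lemma Mod_gt0_cvg p : 1 < p -> (0 < Mod p sigma)%E -> cvgn (series (u p)).
Proof.
move=> p1 Mod0.
have u0 n : 0 < u p n by apply/profile_gt0/level_weight_gt0.
(* The modulus may be infinite, so a finite positive lower bound replaces it. *)
have [m m0 mM] : exists2 m : R, 0 < m & (m%:E <= Mod p sigma)%E.
  case: (Mod p sigma) Mod0 => [r||] //; first by exists r.
  by move=> _; exists 1; rewrite ?leey.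
apply: nondecreasing_is_cvgn.
  by apply: nondecreasing_series => n _ _; exact/ltW.
exists ((m `^ (p - 1)^-1)^-1) => _ [k _ <-].
case: k => [|k].
  by rewrite /series /= big_geq // invr_ge0 powR_ge0.
pose S := series (u p) k.+1.
have S0 : 0 < S.
  rewrite /S /series /= big_nat_recr //= ltr_wpDl //.
  by apply: sumr_ge0 => n _; exact/ltW.
pose h n := if (n < k.+1)%N then u p n * S^-1 else 0.
have h0 n : 0 <= h n by rewrite /h; case: ifP => // _; rewrite mulr_ge0 ?invr_ge0 // ltW.
have hA : Adm (radial h).
  split=> [e|g gG]; first exact: h0.
  rewrite path_length_radial //; apply: le_trans (nneseries_lim_ge k.+1 _); last first.
    by move=> n _ _; rewrite lee_fin.
  rewrite sumEFin lee_fin le_eqVlt; apply/orP; left; apply/eqP.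
  rewrite [RHS](eq_big_nat _ _ (F2 := fun n => u p n * S^-1)); last first.
    by move=> n /andP[_ nk]; rewrite /h nk.
  by rewrite -mulr_suml divff // gt_eqF.
have : (Mod p sigma <= (S^-1 `^ (p - 1))%:E)%E.
  apply: (@le_trans _ _ (energy p sigma (radial h))).
    by apply: ereal_inf_lbound; exists (radial h).
  rewrite energy_radial //; apply: lime_le.
    apply: is_cvg_nneseries => n _ _.
    by rewrite lee_fin mulr_ge0 ?powR_ge0 // ltW // level_weight_gt0.
  near=> N; have kN : (k.+1 <= N)%N by near: N; exact: nbhs_infty_ge.
  rewrite sumEFin lee_fin (big_cat_nat (n := k.+1)) //=.
  rewrite [X in _ + X]big_nat_cond [X in _ + X]big1 ?addr0; last first.
    move=> n /andP[/andP[kn _] _]; rewrite /h ltnNge kn /= powR0 ?mulr0 //; lra.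
  rewrite (eq_big_nat _ _ (F2 := fun n => u p n * (S^-1 * S^-1 `^ (p - 1)))); last first.
    move=> n /andP[_ nk]; rewrite /h nk profile_pow ?invr_gt0 //.
    exact: level_weight_gt0.
  by rewrite -mulr_suml mulrA divff ?mul1r // gt_eqF.
move=> /(le_trans mM); rewrite lee_fin => mS.
rewrite -[leLHS]invrK lef_pV2 ?posrE ?invr_gt0 ?powR_gt0 //.
have q0 : 0 <= (p - 1)^-1 by rewrite invr_ge0; lra.
have := ge0_ler_powR q0 _ _ mS; rewrite !nnegrE powR_ge0 (ltW m0) => /(_ isT isT).
rewrite -powRrM divff ?powRr1 ?invr_ge0 ?(ltW S0) // gt_eqF //; lra.
Unshelve. all: by end_near. Qed.

(** * Optimality and uniqueness of the normalized profile *)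

Definition optimum p : edge G -> R :=
  radial (fun n => u p n / limn (series (u p))).

Section Optimum.
Variable p : R.
Hypothesis p_gt1 : 1 < p.
Hypothesis u_cvg : cvgn (series (u p)).
Let S : R := limn (series (u p)).
Let u_gt0 n : 0 < u p n. Proof. exact/profile_gt0/level_weight_gt0. Qed.
Let S_gt0 : 0 < S. Proof. exact (sum_profile_gt0 level_weight_gt0 u_cvg). Qed.
(** Both the optimal energy and the Lagrange multiplier in [optimum_stationary]. *)
Let M : R := S^-1 `^ (p - 1).
Let h_gt0 n : 0 < u p n / S. Proof. by rewrite divr_gt0. Qed.

Lemma optimum_Adm : Adm (optimum p).
Proof.
split=> [e|g gG]; first exact: ltW (h_gt0 _).
by rewrite path_length_radial // nneseries_EFinMr // divff // gt_eqF.
Qed.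

Lemma energy_optimum : energy p sigma (optimum p) = M%:E.
Proof.
rewrite energy_radial; last by move=> n; exact: ltW (h_gt0 _).
rewrite (eq_eseriesr (g := fun n => (u p n * (S^-1 * S^-1 `^ (p - 1)))%:E)); last first.
  by move=> n _; rewrite profile_pow ?invr_gt0 //; exact: level_weight_gt0.
by rewrite nneseries_EFinMr // mulrA divff ?mul1r // gt_eqF.
Qed.

(** The gradient of the energy at the optimum is a multiple of the flow, so the linear term of the
    tangent inequality sums to a multiple of the mean length. *)
Lemma optimum_stationary e :
  sigma e * optimum p e `^ (p - 1) = M * flow R e.
Proof.
rewrite /optimum /radial powRM ?invr_ge0 ?(ltW (u_gt0 _)) ?(ltW S_gt0) //.
set n := (generation e).-1.
have sE : sigma e = s n.+1 by rewrite sigmaE /n prednK // generation_gt0.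
have N0 : (level_size G n)%:R != 0 :> R.
  rewrite pnatr_eq0 -lt0n.
  exact: level_size_gt0 G_locally_finite G_children G_card_children n e.
apply: (mulIf N0); rewrite /flow -/n -[RHS]mulrA mulVf // mulr1.
have := profile_powB1 level_weight_gt0 n p_gt1; rewrite {1}/level_weight -sE -/M => h.
transitivity (sigma e * (level_size G n)%:R * u p n `^ (p - 1) * M); first by ring.
by rewrite h mul1r.
Qed.

(** The gap in [young_tangent] at [r = optimum p e], weighted by [sigma e]. *)
Definition deficit (rho : edge G -> R) e : R :=
  sigma e * (rho e `^ p + (p - 1) * optimum p e `^ p
    - p * optimum p e `^ (p - 1) * rho e).

Lemma deficit_ge0 rho e : 0 <= rho e -> 0 <= deficit rho e.
Proof.
move=> r0; rewrite mulr_ge0 ?subr_ge0 ?(ltW (sigma_gt0 e)) //.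
exact: (young_tangent p_gt1 r0 (h_gt0 _)).1.
Qed.

Lemma deficit_eq0 rho e : 0 <= rho e -> deficit rho e = 0 -> rho e = optimum p e.
Proof.
move=> r0 /eqP; rewrite mulf_eq0 (gt_eqF (sigma_gt0 e)) /= subr_eq0 eq_sym.
by rewrite (young_tangent p_gt1 r0 (h_gt0 _)).2 => /eqP.
Qed.

Lemma energy_ge_deficit rho : Adm rho ->
  (M%:E + (\esum_(e in [set: edge G]) (deficit rho e)%:E) <= energy p sigma rho)%E.
Proof.
move=> [r0 rA].
have p_gt0 : 0 < p by move: p_gt1; lra.
have M0 : 0 < M by rewrite powR_gt0 ?invr_gt0.
have flow0 e : 0 < flow R e by apply: flow_gt0.
have opt0 e : 0 < optimum p e by exact: h_gt0.
have flow1 := esum_flow_ge1 G_locally_finite G_children G_card_children r0 e0 rA.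
(* The negative term of [deficit] is moved to the other side: all series have nonnegative terms, and
   [energy p sigma rho] may be infinite. *)
have balance : ((\esum_(e in [set: edge G]) (deficit rho e)%:E) +
    (p * M)%:E * (\esum_(e in [set: edge G]) (rho e * flow R e)%:E) =
    energy p sigma rho + (p - 1)%:E * energy p sigma (optimum p))%E.
  have pM0 : 0 <= p * M by rewrite mulr_ge0 // ltW.
  have p10 : 0 <= p - 1 by move: p_gt1; lra.
  rewrite -!esumZl //; last 2 first.
  - by move=> e; rewrite lee_fin mulr_ge0 ?powR_ge0 // ltW.
  - by move=> e; rewrite lee_fin mulr_ge0 // ltW.
  rewrite -!esumD; last 4 first.
  - by move=> e _; rewrite lee_fin mulr_ge0 ?powR_ge0 // ltW.
  - by move=> e _; rewrite -EFinM lee_fin !mulr_ge0 ?powR_ge0 // ltW.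
  - by move=> e _; rewrite lee_fin deficit_ge0.
  - by move=> e _; rewrite -EFinM lee_fin !mulr_ge0 // ltW.
  apply: eq_esum => e _; rewrite -!EFinM -!EFinD; congr _%:E.
  rewrite /deficit.
  have -> : p * M * (rho e * flow R e) = p * rho e * (M * flow R e) by ring.
  by rewrite -optimum_stationary; ring.
(* The mean length is at least one; the finite amount [(p - 1) * M] then cancels. *)
have : ((\esum_(e in [set: edge G]) (deficit rho e)%:E) + (p * M)%:E <=
        energy p sigma rho + ((p - 1) * M)%:E)%E.
  rewrite [((p - 1) * M)%:E]EFinM -[in leRHS]energy_optimum -balance.
  rewrite leeD2l // -[leLHS]mule1 lee_pmul2l //.
  by rewrite lte_fin mulr_gt0.
have -> : p * M = M + (p - 1) * M by ring.
by rewrite [in X in (X -> _)%E]EFinD addeA leeD2rE // addeC.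
Qed.

Lemma Mod_optimum : Mod p sigma = M%:E.
Proof.
apply/eqP; rewrite eq_le; apply/andP; split.
  rewrite -energy_optimum; apply: ereal_inf_lbound.
  by exists (optimum p) => //; exact: optimum_Adm.
apply: le_ereal_inf_tmp => _ [rho rA <-].
apply: le_trans (energy_ge_deficit rA); rewrite leeDl //.
by apply: esum_ge0 => e _; rewrite lee_fin deficit_ge0 //; exact: rA.1.
Qed.

Lemma optimal_density_optimum : optimal_density p sigma (optimum p).
Proof. by split; [exact: optimum_Adm|rewrite energy_optimum Mod_optimum]. Qed.

(** With energy [M] the total deficit vanishes, hence every deficit does, and the equality case of
    [young_tangent] applies. *)
Lemma optimal_density_unique rho : optimal_density p sigma rho -> rho = optimum p.
Proof.
move=> [rA rM]; apply/funext => e; apply: deficit_eq0; first exact: rA.1.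
have D0 f : (0 <= (deficit rho f)%:E)%E by rewrite lee_fin deficit_ge0 //; exact: rA.1.
have : (\esum_(f in [set: edge G]) (deficit rho f)%:E <= 0)%E.
  have := energy_ge_deficit rA; rewrite rM Mod_optimum.
  by rewrite -[leRHS]adde0 leeD2lE.
move=> D_le0; apply/eqP; rewrite eq_le -!lee_fin D0 andbT.
apply: le_trans D_le0; apply: esum_ge; exists [set e]; first by split.
by rewrite fsbig_set1.
Qed.

End Optimum.
End RadialModulus.

(** * Existence, uniqueness and continuity of the optimal density *)

Theorem theorem9 (R : realType) (G : rooted_tree) (sigma : edge G -> R)
  (sigma_gt0 : forall e, 0 < sigma e)
  (G_radial : radially_symmetric_tree G)
  (sigma_radial : radially_symmetric_weight sigma)
  (p0 : R) (p0_gt1 : 1 < p0)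
  (Mod_gt0 : \forall p \near p0, (0 < Mod p sigma)%E)
  (e : edge G) :
  (\forall p \near p0, exists! rho, optimal_density p sigma rho) /\
  (forall rho : R -> edge G -> R,
     (\forall p \near p0, optimal_density p sigma (rho p)) ->
     {for p0, continuous (fun p => rho p e)}).
Proof.
have [[_ G_lf G_ch] [c G_card]] := G_radial; have [s sigmaE] := sigma_radial.
have near_cvg : \forall p \near p0,
    1 < p /\ cvgn (series (profile (level_weight G s) p)).
  near=> p; have p1 : 1 < p by near: p; exact: lt_nbhsr.
  split=> //; apply: (Mod_gt0_cvg e sigma_gt0 sigmaE G_lf G_ch G_card p1).
  by near: p.
split.
  near=> p; have [p1 cu] : 1 < p /\ cvgn (series (profile (level_weight G s) p)).
    by near: p.
  exists (optimum s p); split.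
    exact: (optimal_density_optimum e sigma_gt0 sigmaE G_lf G_ch G_card p1 cu).
  move=> rho rho_opt; apply/esym.
  exact: (optimal_density_unique e sigma_gt0 sigmaE G_lf G_ch G_card p1 cu).
move=> rho rho_opt.
have w0 := level_weight_gt0 e sigma_gt0 sigmaE G_lf G_ch G_card.
have rhoE : \forall p \near p0, optimum s p e = rho p e.
  near=> p; have [p1 cu] : 1 < p /\ cvgn (series (profile (level_weight G s) p)).
    by near: p.
  suff /(optimal_density_unique e sigma_gt0 sigmaE G_lf G_ch G_card p1 cu) -> :
    optimal_density p sigma (rho p) by [].
  by near: p.
(* By uniqueness [rho p e] agrees with [optimum s p e] near [p0] and at [p0] itself, so it suffices
   to treat the latter, a quotient of continuous functions. *)
rewrite /prop_for /continuous_at /= -(nbhs_singleton rhoE).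
apply: cvg_trans (near_eq_cvg rhoE) _; rewrite /optimum /radial.
have [_ cu0] := nbhs_singleton near_cvg.
apply: cvgM; first exact: profile_continuous.
apply: cvgV; first by rewrite gt_eqF // sum_profile_gt0.
apply: continuous_sum_profile => //.
by near=> p; have [] := near near_cvg p.
Unshelve. all: by end_near. Qed.
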